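(* Let $G>0$, $T>0$, and let $F\colon\mathbb R\to\mathbb R^2$ be $T$-periodic and of class $C^1$. Then the equation \[ \ddot x=\left(G\sqrt{1-|x|^2}-\frac{(x^T\dot x)^2}{1-|x|^2}-|\dot x|^2\right)x+(x^TF(t))x-F(t) \] has a $T$-periodic solution $x\colon\mathbb R\to\{z\in\mathbb R^2:|z|<1\}$.
   Context: $|\cdot|$ denotes the Euclidean norm on $\mathbb R^2$ and $x^Ty$ the scalar product. *)

(* Defs.v *)
From Stdlib Require Import Reals.
From Coquelicot Require Import Coquelicot.
Open Scope R_scope.

Definition nrm2 (x1 x2 : R) : R := x1 ^ 2 + x2 ^ 2.
Definition dot2 (x1 x2 y1 y2 : R) : R := x1 * y1 + x2 * y2.

Definition is_C1 (f : R -> R) : Prop :=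
  (forall t, ex_derive f t) /\ (forall t, continuous (Derive f) t).

Definition coef (G x1 x2 v1 v2 : R) : R :=
  G * sqrt (1 - nrm2 x1 x2) - (dot2 x1 x2 v1 v2) ^ 2 / (1 - nrm2 x1 x2)
  - nrm2 v1 v2.

(* Main.v *)
Require Import Defs.
From Stdlib Require Import Reals Lra Lia ZArith Classical.
From Coquelicot Require Import Coquelicot.
From mathcomp.classical Require boolp filter.
Open Scope R_scope.

(* With z = sqrt (1 - |x|^2) and q = (x, z) the equation says that q moves on the
   unit sphere under the constraint force and the force -f, f = (F, G); it is the
   Euler-Lagrange equation of the action "integral of |q'|^2/2 - f.q".  We minimise
   over loops in the closed upper hemisphere.  After discretising with step h this
   means maximising the sum of q_{k+1}.q_k + h^2 f_k.q_k.  As a function of the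
   single vertex q_k the sum is w.q_k + const with w = q_{k+1} + q_{k-1} + h^2 f_k,
   and w has positive height because G > 0; so the optimal q_k is w/|w| and the
   boundary of the hemisphere plays no role.  Comparing with the constant loop at
   the north pole bounds the energy; as the velocity has mean zero and its
   increments are controlled by the energy, the velocity and then the acceleration
   are bounded uniformly in h.  At the lowest vertex the equation keeps the height
   above a positive constant.  Discrete Taylor estimates with uniform constants
   survive the pointwise limit h -> 0 along an ultrafilter and turn into
   derivatives. *)

(** * Limits along an ultrafilter *)

(** One such ultrafilter makes all bounded real sequences converge simultaneously. It replaces the
    extraction of subsequences, both for the vertices of a maximising sequence and for the
    uncountably many times in the continuum limit. *)
Lemma nonprincipal_ultrafilter :
  exists U : (nat -> Prop) -> Prop,
    ProperFilter U /\ (forall A, U A \/ U (fun n => ~ A n)) /\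
    filter_le U eventually.
Proof.
  (* Two notions of proper filter are in play: one demands that the empty set is not a member, the
     other that every member is inhabited. The way back between them is classical. *)
  assert (E : @filter.ProperFilter nat eventually).
  { split.
    - intros [N HN]; exact (HN N (le_n N)).
    - split.
      + now exists 0%nat.
      + intros A B HA HB; exact (filter_and _ _ HA HB).
      + intros A B HAB HA; exact (filter_imp _ _ HAB HA). }
  destruct (filter.ultraFilterLemma E) as [U [UU UE]].
  pose proof (@filter.ultra_proper _ _ UU) as [U0 UF].
  exists U; split; [split|split].
  - intros P HP; apply NNPP; intros HN; apply U0.
    refine (filter.filterS (Filter := UF) _ HP).
    intros n Hn; destruct HN; now exists n.
  - split.
    + exact (filter.filterT (Filter := UF)).
    + intros P Q HP HQ; exact (filter.filterI (Filter := UF) HP HQ).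
    + intros P Q HPQ HP; exact (filter.filterS (Filter := UF) HPQ HP).
  - intros A; destruct (filter.in_ultra_setVsetC A UU) as [H|H]; [now left|now right].
  - exact UE.
Qed.

(** The limit is the supremum of the [x] that lie below [a n] for [U]-many [n]. Being a supremum
    gives the lower estimate. The upper one uses that [U] decides every set: if [l + eps / 2 <= a n]
    held on a member of [U], then [l] would not be an upper bound. *)
Lemma ultrafilter_limit (U : (nat -> Prop) -> Prop) {UU : ProperFilter U}
  (ultra : forall A, U A \/ U (fun n => ~ A n)) (a : nat -> R) (M : R) :
  (forall n, Rabs (a n) <= M) -> exists l, filterlim a U (locally l).
Proof.
  intros Ha.
  assert (Ha' : forall n, - M <= a n <= M) by (intros n; now apply Rabs_le_between).
  destruct (completeness (fun x => U (fun n => x <= a n))) as [l [ub lub]].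
  - exists M; intros x Hx.
    destruct (filter_ex _ Hx) as [n Hn]; specialize (Ha' n); lra.
  - exists (- M); apply filter_forall; intros n; apply Ha'.
  - exists l; apply filterlim_locally; intros [eps Heps]; simpl.
    assert (H1 : U (fun n => l - eps / 2 <= a n)).
    { apply NNPP; intros H.
      assert (l <= l - eps / 2); [|lra].
      apply lub; intros x Hx; apply Rnot_lt_le; intros Hlt; apply H.
      revert Hx; apply filter_imp; intros n Hn; lra. }
    assert (H2 : U (fun n => ~ l + eps / 2 <= a n)).
    { destruct (ultra (fun n => l + eps / 2 <= a n)) as [H|H]; [|exact H].
      specialize (ub _ H); lra. }
    generalize (filter_and _ _ H1 H2); apply filter_imp; intros n [Hn1 Hn2].
    apply Rabs_lt_between'; lra.
Qed.

Section Limits.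
Context {U : (nat -> Prop) -> Prop} {UU : ProperFilter U}.

Lemma flim_plus (a b : nat -> R) (x y : R) :
  filterlim a U (locally x) -> filterlim b U (locally y) ->
  filterlim (fun n => a n + b n) U (locally (x + y)).
Proof.
  intros Ha Hb; exact (filterlim_comp_2 _ _ _ Ha Hb (filterlim_plus x y)).
Qed.

Lemma flim_mult (a b : nat -> R) (x y : R) :
  filterlim a U (locally x) -> filterlim b U (locally y) ->
  filterlim (fun n => a n * b n) U (locally (x * y)).
Proof.
  intros Ha Hb; exact (filterlim_comp_2 _ _ _ Ha Hb (filterlim_mult x y)).
Qed.

Lemma flim_opp (a : nat -> R) (x : R) :
  filterlim a U (locally x) -> filterlim (fun n => - a n) U (locally (- x)).
Proof.
  intros Ha; exact (filterlim_comp _ _ _ _ _ _ _ _ Ha (filterlim_opp x)).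
Qed.

Lemma flim_minus (a b : nat -> R) (x y : R) :
  filterlim a U (locally x) -> filterlim b U (locally y) ->
  filterlim (fun n => a n - b n) U (locally (x - y)).
Proof.
  intros Ha Hb; apply flim_plus; [exact Ha|now apply flim_opp].
Qed.

Lemma flim_const (x : R) : filterlim (fun _ : nat => x) U (locally x).
Proof. apply filterlim_const. Qed.

Lemma flim_continuous (f : R -> R) (a : nat -> R) (x : R) :
  continuous f x -> filterlim a U (locally x) ->
  filterlim (fun n => f (a n)) U (locally (f x)).
Proof.
  intros Hf Ha; exact (filterlim_comp _ _ _ _ _ _ _ _ Ha Hf).
Qed.

Lemma flim_abs (a : nat -> R) (x : R) :
  filterlim a U (locally x) ->
  filterlim (fun n => Rabs (a n)) U (locally (Rabs x)).
Proof. apply flim_continuous, continuous_Rabs. Qed.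

Lemma flim_le (a b : nat -> R) (x y : R) :
  (forall n, a n <= b n) ->
  filterlim a U (locally x) -> filterlim b U (locally y) -> x <= y.
Proof.
  intros H Ha Hb.
  exact (filterlim_le a b x y (filter_forall _ H) Ha Hb).
Qed.

Lemma flim_unique (a : nat -> R) (x y : R) :
  filterlim a U (locally x) -> filterlim a U (locally y) -> x = y.
Proof.
  intros Hx Hy; apply Rle_antisym;
    [apply (flim_le a a x y)|apply (flim_le a a y x)];
    auto; intros; apply Rle_refl.
Qed.

Lemma flim_sum (a : nat -> nat -> R) (x : nat -> R) (m : nat) :
  (forall k, filterlim (fun n => a n k) U (locally (x k))) ->
  filterlim (fun n => sum_f_R0 (a n) m) U (locally (sum_f_R0 x m)).
Proof.
  intros H; induction m as [|m IH]; [apply H|].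
  simpl; apply flim_plus; [exact IH|apply H].
Qed.

End Limits.

(** * Maximising loops *)

(** Vectors are functions on a three-element type, so that coordinatewise statements need a single
    quantifier. The third axis is the height. *)
Inductive axis := ax1 | ax2 | ax3.

Definition vec := axis -> R.

Definition dot (u v : vec) : R := u ax1 * v ax1 + u ax2 * v ax2 + u ax3 * v ax3.

Definition north : vec := fun c => match c with ax3 => 1 | _ => 0 end.

(** There are [m + 1] summands, one full period of a loop with [S m] vertices. *)
Definition psum (m : nat) (g : Z -> R) (a : Z) : R :=
  sum_f_R0 (fun k => g (a + Z.of_nat k)%Z) m.

Lemma psum_succ (m : nat) (g : Z -> R) (a : Z) :
  psum m g (a + 1) = psum m g a - g a + g (a + Z.of_nat (S m))%Z.
Proof.
  unfold psum; induction m as [|m IH].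
  - simpl; rewrite !Z.add_0_r; ring.
  - rewrite !tech5, IH.
    replace (a + 1 + Z.of_nat (S m))%Z with (a + Z.of_nat (S (S m)))%Z by lia; ring.
Qed.

(** Moving the window by one trades [g a] for [g (a + S m)], which periodicity makes equal. *)
Lemma psum_shift (m : nat) (g : Z -> R) (a b : Z) :
  (forall i, g (i + Z.of_nat (S m))%Z = g i) -> psum m g a = psum m g b.
Proof.
  intros Hg.
  assert (Hs : forall i, psum m g (i + 1) = psum m g i).
  { intros i; rewrite psum_succ, Hg; ring. }
  assert (Hk : forall k i, psum m g (i + Z.of_nat k) = psum m g i).
  { induction k as [|k IH]; intros i; [now rewrite Z.add_0_r|].
    replace (i + Z.of_nat (S k))%Z with (i + Z.of_nat k + 1)%Z by lia.
    now rewrite Hs, IH. }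
  destruct (Z_le_gt_dec a b).
  - rewrite <- (Hk (Z.to_nat (b - a)) a); f_equal; lia.
  - rewrite <- (Hk (Z.to_nat (a - b)) b); f_equal; lia.
Qed.

Lemma psum_le (m : nat) (g g' : Z -> R) (a : Z) :
  (forall i, g i <= g' i) -> psum m g a <= psum m g' a.
Proof. intros H; apply sum_Rle; intros; apply H. Qed.

Lemma psum_plus (m : nat) (g g' : Z -> R) (a : Z) :
  psum m (fun i => g i + g' i) a = psum m g a + psum m g' a.
Proof. apply plus_sum. Qed.

Lemma psum_scal (m : nat) (g : Z -> R) (x : R) (a : Z) :
  psum m (fun i => x * g i) a = x * psum m g a.
Proof.
  unfold psum; rewrite scal_sum; apply sum_eq; intros; ring.
Qed.

Lemma psum_const (m : nat) (x : R) (a : Z) :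
  psum m (fun _ => x) a = INR (S m) * x.
Proof. unfold psum; rewrite sum_cte; ring. Qed.

(* Closed upper-hemisphere loops with [S m] vertices. *)
Definition loop (m : nat) (q : Z -> vec) : Prop :=
  (forall i c, q (i + Z.of_nat (S m))%Z c = q i c) /\
  (forall i, dot (q i) (q i) = 1) /\
  (forall i, 0 <= q i ax3).

(* On unit vectors [1 - dot u v = |u - v|^2 / 2], so maximising the sum of this
   density minimises the discretised action. *)
Definition density (e q : Z -> vec) (i : Z) : R :=
  dot (q (i + 1)%Z) (q i) + dot (e i) (q i).

Lemma unit_coord (u : vec) (c : axis) : dot u u = 1 -> Rabs (u c) <= 1.
Proof.
  assert (K : forall x, x * x <= 1 -> - 1 <= x <= 1) by (intros x Hx; split; nra).
  unfold dot; intros H; apply Rabs_le, K.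
  generalize (Rle_0_sqr (u ax1)), (Rle_0_sqr (u ax2)), (Rle_0_sqr (u ax3)).
  unfold Rsqr; destruct c; intros; lra.
Qed.

Lemma dot_le_norm1 (u v : vec) :
  dot v v = 1 -> Rabs (dot u v) <= Rabs (u ax1) + Rabs (u ax2) + Rabs (u ax3).
Proof.
  intros H.
  assert (K : forall c, Rabs (u c * v c) <= Rabs (u c)).
  { intros c; rewrite Rabs_mult; rewrite <- (Rmult_1_r (Rabs (u c))) at 2.
    apply Rmult_le_compat_l; [apply Rabs_pos|now apply unit_coord]. }
  unfold dot.
  generalize (Rabs_triang (u ax1 * v ax1 + u ax2 * v ax2) (u ax3 * v ax3)),
    (Rabs_triang (u ax1 * v ax1) (u ax2 * v ax2)), (K ax1), (K ax2), (K ax3); intros; lra.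
Qed.

Lemma dot_unit_le (u v : vec) : dot u u = 1 -> dot v v = 1 -> dot u v <= 1.
Proof.
  unfold dot; intros Hu Hv.
  generalize (Rle_0_sqr (u ax1 - v ax1)), (Rle_0_sqr (u ax2 - v ax2)),
    (Rle_0_sqr (u ax3 - v ax3)); unfold Rsqr; intros; lra.
Qed.

Lemma north_loop (m : nat) : loop m (fun _ => north).
Proof. repeat split; intros; unfold dot; simpl; lra. Qed.

(** Direct method: along the ultrafilter every coordinate of a maximising sequence of loops
    converges. The constraints are closed and the sum consists of finitely many continuous terms, so
    the limit is a loop that attains the supremum. *)
Lemma exists_maximal_loop (m : nat) (e : Z -> vec) :
  exists q, loop m q /\
    forall p, loop m p -> psum m (density e p) 0 <= psum m (density e q) 0.
Proof.
  destruct nonprincipal_ultrafilter as [U [UU [ultra Ule]]].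
  set (B q := psum m (density e q) 0).
  destruct (completeness (fun x => exists q, loop m q /\ x = B q)) as [S0 [ub lub]].
  - exists (psum m (fun i =>
      1 + (Rabs (e i ax1) + Rabs (e i ax2) + Rabs (e i ax3))) 0).
    intros x [q [[Hp [Hu Hz]] ->]]; apply psum_le; intros i; unfold density.
    apply Rplus_le_compat; [now apply dot_unit_le|].
    apply Rle_trans with (1 := Rle_abs _), dot_le_norm1, Hu.
  - exists (B (fun _ => north)); exists (fun _ => north); split; [apply north_loop|reflexivity].
  - assert (Hn : forall n : nat, exists q, loop m q /\ S0 - / INR (S n) <= B q).
    { intros n; apply NNPP; intros HN.
      assert (Hpos : 0 < / INR (S n)) by (apply Rinv_0_lt_compat, lt_0_INR; lia).
      assert (S0 <= S0 - / INR (S n)); [|lra].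
      apply lub; intros x [q [Hq ->]]; apply Rnot_lt_le; intros Hlt; apply HN.
      exists q; split; [exact Hq|lra]. }
    destruct (boolp.choice Hn) as [p Hp].
    (* Indexing by vertex and axis together lets a single choice pick all the limits. *)
    assert (Hl : forall ic : Z * axis, exists l,
      filterlim (fun n => p n (fst ic) (snd ic)) U (locally l)).
    { intros [i c]; apply (ultrafilter_limit U ultra _ 1); intros n.
      apply unit_coord, (Hp n). }
    destruct (boolp.choice Hl) as [ql Hql].
    set (q := fun i c => ql (i, c)).
    assert (Hq : forall i c, filterlim (fun n => p n i c) U (locally (q i c)))
      by (intros i c; exact (Hql (i, c))).
    assert (Hdot : forall i j,
      filterlim (fun n => dot (p n i) (p n j)) U (locally (dot (q i) (q j)))).
    { intros i j; unfold dot; repeat apply flim_plus; apply flim_mult; apply Hq. }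
    exists q; split; [split; [|split]|].
    + intros i c; apply (flim_unique (U := U) (fun n => p n i c)); [|apply Hq].
      apply filterlim_ext with (2 := Hq _ c); intros n; apply (Hp n).
    + intros i; apply (flim_unique (U := U) (fun _ => 1)); [|apply flim_const].
      apply filterlim_ext with (2 := Hdot i i); intros n; apply (Hp n).
    + intros i; apply (flim_le (U := U) (fun _ => 0) (fun n => p n i ax3));
        [intros n; apply (Hp n)|apply flim_const|apply Hq].
    + intros p' Hp'; apply Rle_trans with S0; [apply ub; now exists p'|].
      apply (flim_le (U := U) (fun n => S0 - / INR (S n)) (fun n => B (p n)));
        [intros n; apply (Hp n)| |].
      * rewrite <- (Rminus_0_r S0) at 1; apply flim_minus; [apply flim_const|].
        apply (filterlim_filter_le_1 _ Ule).
        apply (is_lim_seq_incr_1 (fun n => / INR n) 0).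
        replace (Finite 0) with (Rbar_inv p_infty) by reflexivity.
        apply is_lim_seq_inv; [apply is_lim_seq_INR|discriminate].
      * unfold B, psum; apply flim_sum; intros k; unfold density, dot.
        repeat apply flim_plus; apply flim_mult; try apply Hq; apply flim_const.
Qed.

(** This is the Euler-Lagrange equation. Replacing vertex [i] by [w / |w|] is admissible because [w]
    points strictly upwards, and maximality then gives [|w| <= w.q_i]. This is equality in the
    Cauchy-Schwarz inequality, so [w] is a multiple of [q i]. With at least two vertices the
    neighbours of [i] stay unchanged. *)
Lemma maximal_loop_equation (m : nat) (e q : Z -> vec) :
  (1 <= m)%nat ->
  (forall i c, e (i + Z.of_nat (S m))%Z c = e i c) ->
  (forall i, 0 < e i ax3) -> loop m q ->
  (forall p, loop m p -> psum m (density e p) 0 <= psum m (density e q) 0) ->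
  forall i, exists mu, forall c, q (i + 1)%Z c + q (i - 1)%Z c + e i c = mu * q i c.
Proof.
  intros Hm He He3 [Hp [Hu Hz]] Hmax i.
  set (w := fun c => q (i + 1)%Z c + q (i - 1)%Z c + e i c).
  assert (Hw3 : 0 < w ax3).
  { unfold w; generalize (Hz (i + 1)%Z), (Hz (i - 1)%Z), (He3 i); intros; lra. }
  assert (Hww : 0 < dot w w) by (unfold dot; nra).
  set (mu := sqrt (dot w w)).
  assert (Hmu : 0 < mu) by now apply sqrt_lt_R0.
  assert (Hmu2 : mu * mu = dot w w) by (apply sqrt_sqrt; lra).
  set (u := fun c => w c / mu).
  set (P := Z.of_nat (S m)) in *.
  (* The change is made on the whole residue class of [i], so that [p] is again periodic. *)
  set (p := fun j => if Z.eqb ((j - i) mod P) 0 then u else q j).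
  assert (HP : (P >= 2)%Z) by lia.
  assert (Huu : dot u u = 1).
  { unfold dot, u.
    replace (_ + _ + _) with (dot w w / (mu * mu)) by (unfold dot; field; lra).
    rewrite Hmu2; field; lra. }
  assert (Hloop : loop m p).
  { split; [|split].
    - intros j c; unfold p; fold P.
      replace (j + P - i)%Z with (j - i + 1 * P)%Z by ring.
      rewrite Z_mod_plus_full; destruct (Z.eqb _ _); [reflexivity|apply Hp].
    - intros j; unfold p; destruct (Z.eqb _ _); [exact Huu|apply Hu].
    - intros j; unfold p; destruct (Z.eqb _ _); [|apply Hz].
      unfold u; apply Rlt_le, Rdiv_lt_0_compat; lra. }
  assert (Hpi : p i = u).
  { unfold p; rewrite Z.sub_diag, Zmod_0_l; reflexivity. }
  assert (Hpj : forall j, (0 < j < P)%Z -> p (i + j)%Z = q (i + j)%Z).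
  { intros j Hj; unfold p; replace (i + j - i)%Z with j by ring.
    rewrite Z.mod_small by lia; destruct (Z.eqb_spec j 0); [lia|reflexivity]. }
  assert (Hpm : forall c, p (i - 1)%Z c = q (i - 1)%Z c).
  { intros c; destruct Hloop as [Hp' _].
    rewrite <- (Hp' (i - 1)%Z), <- (Hp (i - 1)%Z); fold P.
    replace (i - 1 + P)%Z with (i + (P - 1))%Z by ring.
    rewrite Hpj; [reflexivity|lia]. }
  assert (Hdens : forall r : Z -> vec, (forall j c, r (j + P)%Z c = r j c) ->
    forall j, density e r (j + P)%Z = density e r j).
  { intros r Hr j; unfold density, dot.
    replace (j + P + 1)%Z with (j + 1 + P)%Z by ring.
    now rewrite !Hr, !He. }
  (* Vertex [i] enters only the densities at [i - 1] and [i]. Starting the window at [i - 1] puts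
     these two first, and the remaining terms end before the next copy of the vertex, so they
     cancel. *)
  assert (Hdiff : psum m (density e p) (i - 1) - psum m (density e q) (i - 1)
                  = dot w u - dot w (q i)).
  { unfold psum; rewrite <- minus_sum, decomp_sum by lia.
    assert (Hd0 : density e p (i - 1) - density e q (i - 1) =
       dot u (q (i - 1)%Z) - dot (q i) (q (i - 1)%Z)).
    { unfold density; replace (i - 1 + 1)%Z with i by ring; rewrite Hpi.
      unfold dot; rewrite !Hpm; ring. }
    assert (Hd1 : density e p i - density e q i =
       dot (q (i + 1)%Z) u - dot (q (i + 1)%Z) (q i) + dot (e i) u - dot (e i) (q i)).
    { unfold density; rewrite Hpi, Hpj by lia; ring. }
    assert (Hd2 : forall k, (0 < k < P - 1)%Z ->
      density e p (i + k) - density e q (i + k) = 0).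
    { intros k Hk; unfold density; rewrite <- Z.add_assoc.
      rewrite !Hpj by lia; ring. }
    assert (Hrest : forall k, (S k <= m)%nat ->
      sum_f_R0 (fun k => density e p (i - 1 + Z.of_nat (S k))
                         - density e q (i - 1 + Z.of_nat (S k))) k
      = density e p i - density e q i).
    { induction k as [|k IH]; intros Hk.
      - simpl; now replace (i - 1 + 1)%Z with i by ring.
      - rewrite tech5, IH by lia.
        replace (i - 1 + Z.of_nat (S (S k)))%Z with (i + Z.of_nat (S k))%Z by lia.
        rewrite Hd2 by lia; ring. }
    rewrite Hrest by lia; rewrite Z.add_0_r, Hd0, Hd1.
    unfold dot, w; ring. }
  assert (Hle : dot w u <= dot w (q i)).
  { generalize (Hmax p Hloop).
    rewrite (psum_shift m (density e p) 0 (i - 1)) by (apply Hdens, Hloop).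
    rewrite (psum_shift m (density e q) 0 (i - 1)) by (apply Hdens, Hp).
    intros; lra. }
  assert (Hwu : dot w u = mu).
  { unfold dot, u.
    replace (_ + _ + _) with (dot w w / mu) by (unfold dot; field; lra).
    rewrite <- Hmu2; field; lra. }
  exists mu.
  (* [|w - mu q|^2 = 2 mu (mu - w.q) <= 0] *)
  assert (Hsq : dot (fun c => w c - mu * q i c) (fun c => w c - mu * q i c) <= 0).
  { replace (dot _ _) with (dot w w - 2 * mu * dot w (q i) + mu * mu * dot (q i) (q i))
      by (unfold dot; ring).
    rewrite Hu, <- Hmu2; nra. }
  intros c; fold (w c); apply Rminus_diag_uniq, Rsqr_0_uniq, Rle_antisym; [|apply Rle_0_sqr].
  generalize (Rle_0_sqr (w ax1 - mu * q i ax1)), (Rle_0_sqr (w ax2 - mu * q i ax2)),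
    (Rle_0_sqr (w ax3 - mu * q i ax3)).
  unfold dot, Rsqr in *; destruct c; intros; lra.
Qed.

(** * Estimates uniform in the mesh *)

Lemma Rabs_mult_le (a b A B : R) :
  Rabs a <= A -> Rabs b <= B -> Rabs (a * b) <= A * B.
Proof.
  intros Ha Hb; rewrite Rabs_mult; apply Rmult_le_compat; auto using Rabs_pos.
Qed.

Lemma Rabs_plus_le (a b A B : R) :
  Rabs a <= A -> Rabs b <= B -> Rabs (a + b) <= A + B.
Proof. intros Ha Hb; generalize (Rabs_triang a b); intros; lra. Qed.

Lemma Rabs_minus_le (a b A B : R) :
  Rabs a <= A -> Rabs b <= B -> Rabs (a - b) <= A + B.
Proof.
  intros Ha Hb; apply Rabs_plus_le; [exact Ha|now rewrite Rabs_Ropp].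
Qed.

Lemma Rabs_mult_minus_le (a b a' b' A B x y : R) :
  Rabs a <= A -> Rabs b' <= B -> Rabs (a' - a) <= x -> Rabs (b' - b) <= y ->
  Rabs (a' * b' - a * b) <= x * B + A * y.
Proof.
  intros; replace (a' * b' - a * b) with ((a' - a) * b' + a * (b' - b)) by ring.
  apply Rabs_plus_le; now apply Rabs_mult_le.
Qed.

Lemma dot_bound (u v : vec) (A B : R) :
  (forall c, Rabs (u c) <= A) -> (forall c, Rabs (v c) <= B) ->
  Rabs (dot u v) <= 3 * (A * B).
Proof.
  intros Hu Hv.
  replace (3 * (A * B)) with (A * B + A * B + A * B) by ring.
  repeat apply Rabs_plus_le; apply Rabs_mult_le; auto.
Qed.

Lemma dot_minus_bound (u v u' v' : vec) (A B x y : R) :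
  (forall c, Rabs (u c) <= A) -> (forall c, Rabs (v' c) <= B) ->
  (forall c, Rabs (u' c - u c) <= x) -> (forall c, Rabs (v' c - v c) <= y) ->
  Rabs (dot u' v' - dot u v) <= 3 * (x * B + A * y).
Proof.
  intros Hu Hv Hx Hy.
  replace (dot u' v' - dot u v) with
    ((u' ax1 * v' ax1 - u ax1 * v ax1) + (u' ax2 * v' ax2 - u ax2 * v ax2)
     + (u' ax3 * v' ax3 - u ax3 * v ax3)) by (unfold dot; ring).
  replace (3 * (x * B + A * y)) with
    (x * B + A * y + (x * B + A * y) + (x * B + A * y)) by ring.
  apply Rabs_plus_le; [apply Rabs_plus_le|]; apply Rabs_mult_minus_le; auto.
Qed.

(** * Discrete Taylor estimates *)

Lemma discrete_taylor_up (h E M : R) (a b : Z -> R) :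
  0 < h -> 0 <= M ->
  (forall i, Rabs (a (i + 1)%Z - a i - h * b i) <= E * h ^ 2) ->
  (forall i, Rabs (b (i + 1)%Z - b i) <= M * h) ->
  forall (k : nat) (i : Z),
    Rabs (b (i + Z.of_nat k)%Z - b i) <= M * (h * INR k) /\
    Rabs (a (i + Z.of_nat k)%Z - a i - h * INR k * b i)
      <= h * INR k * (E * h + M * (h * INR k)).
Proof.
  (* Both bounds go through one induction: the step for [a] consumes the drift of [b] accumulated so
     far. *)
  intros Hh HM Ha Hb k i; induction k as [|k [IHb IHa]].
  - simpl; rewrite Z.add_0_r.
    replace (b i - b i) with 0 by ring.
    replace (a i - a i - h * 0 * b i) with 0 by ring.
    rewrite Rabs_R0; split; lra.
  - replace (i + Z.of_nat (S k))%Z with (i + Z.of_nat k + 1)%Z by lia.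
    rewrite S_INR; set (x := INR k) in *; set (j := (i + Z.of_nat k)%Z) in *.
    assert (Hx : 0 <= x) by apply pos_INR.
    split.
    + replace (b (j + 1)%Z - b i) with ((b (j + 1)%Z - b j) + (b j - b i)) by ring.
      replace (M * (h * (x + 1))) with (M * h + M * (h * x)) by ring.
      now apply Rabs_plus_le.
    + replace (a (j + 1)%Z - a i - h * (x + 1) * b i) with
        ((a (j + 1)%Z - a j - h * b j) + h * (b j - b i)
         + (a j - a i - h * x * b i)) by ring.
      apply Rle_trans with
        (E * h ^ 2 + h * (M * (h * x)) + h * x * (E * h + M * (h * x))).
      * apply Rabs_plus_le; [apply Rabs_plus_le; [apply Ha|]|exact IHa].
        rewrite Rabs_mult, (Rabs_right h) by lra.
        apply Rmult_le_compat_l; lra.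
      * assert (0 <= M * (h * h)) by (apply Rmult_le_pos; nra).
        assert (0 <= M * (h * h) * x) by now apply Rmult_le_pos.
        nra.
Qed.

(** For [j] left of [i] the forward estimate is applied from [j]. Exchanging the slope [b j] for
    [b i] then costs a second [M * d], hence the factor 2. *)
Lemma discrete_taylor (h E M : R) (a b : Z -> R) :
  0 < h -> 0 <= M ->
  (forall i, Rabs (a (i + 1)%Z - a i - h * b i) <= E * h ^ 2) ->
  (forall i, Rabs (b (i + 1)%Z - b i) <= M * h) ->
  forall i j,
    Rabs (a j - a i - (h * IZR j - h * IZR i) * b i)
      <= Rabs (h * IZR j - h * IZR i) * (E * h + 2 * M * Rabs (h * IZR j - h * IZR i)).
Proof.
  intros Hh HM Ha Hb.
  assert (up := discrete_taylor_up h E M a b Hh HM Ha Hb).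
  intros i j; destruct (Z_le_gt_dec i j) as [Hij|Hij].
  - destruct (up (Z.to_nat (j - i)) i) as [_ H].
    replace (i + Z.of_nat (Z.to_nat (j - i)))%Z with j in H by lia.
    rewrite INR_IZR_INZ, Z2Nat.id, minus_IZR, Rmult_minus_distr_l in H by lia.
    assert (Hd : 0 <= h * IZR j - h * IZR i).
    { rewrite <- Rmult_minus_distr_l, <- minus_IZR.
      apply Rmult_le_pos; [lra|apply IZR_le; lia]. }
    rewrite (Rabs_right (h * IZR j - h * IZR i)) by lra.
    apply Rle_trans with (1 := H), Rmult_le_compat_l; [exact Hd|].
    apply Rplus_le_compat_l, Rmult_le_compat_r; lra.
  - destruct (up (Z.to_nat (i - j)) j) as [Hb' H].
    replace (j + Z.of_nat (Z.to_nat (i - j)))%Z with i in H, Hb' by lia.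
    rewrite INR_IZR_INZ, Z2Nat.id, minus_IZR, Rmult_minus_distr_l in H, Hb' by lia.
    assert (Hd : 0 <= h * IZR i - h * IZR j).
    { rewrite <- Rmult_minus_distr_l, <- minus_IZR.
      apply Rmult_le_pos; [lra|apply IZR_le; lia]. }
    rewrite (Rabs_minus_sym (h * IZR j)), (Rabs_right (h * IZR i - h * IZR j)) by lra.
    set (d := h * IZR i - h * IZR j) in *.
    replace (a j - a i - (h * IZR j - h * IZR i) * b i) with
      (d * (b i - b j) - (a i - a j - d * b j)) by (unfold d; ring).
    replace (d * (E * h + 2 * M * d)) with (d * (M * d) + d * (E * h + M * d)) by ring.
    apply Rabs_minus_le; [|exact H].
    apply Rabs_mult_le; [rewrite Rabs_right; lra|exact Hb'].
Qed.

Lemma psum_widen (k m : nat) (g : Z -> R) (a : Z) :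
  (forall i, 0 <= g i) -> (k <= m)%nat -> psum k g a <= psum m g a.
Proof.
  intros Hg Hk; induction Hk as [|l Hk IH]; [apply Rle_refl|].
  unfold psum in *; rewrite tech5; cbv beta; generalize (Hg (a + Z.of_nat (S l))%Z); intros; lra.
Qed.

Lemma argmin (g : nat -> R) (k : nat) :
  exists j, (j <= k)%nat /\ forall l, (l <= k)%nat -> g j <= g l.
Proof.
  induction k as [|k [j [Hj IH]]].
  - exists 0%nat; split; [lia|]; intros l Hl; replace l with 0%nat by lia; lra.
  - destruct (Rle_dec (g j) (g (S k))) as [H|H].
    + exists j; split; [lia|]; intros l Hl.
      destruct (Nat.eq_dec l (S k)) as [->|]; [exact H|apply IH; lia].
    + exists (S k); split; [lia|]; intros l Hl.
      destruct (Nat.eq_dec l (S k)) as [->|]; [lra|].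
      apply Rle_trans with (g j); [lra|apply IH; lia].
Qed.

(** * A priori estimates for the maximal loop *)

Section Estimates.

Context (m : nat) (h T G Cf Lf : R) (f q : Z -> vec).
Hypothesis m_pos : (1 <= m)%nat.
Hypothesis h_pos : 0 < h.
Hypothesis G_pos : 0 < G.
Hypothesis period : h * INR (S m) = T.
Hypothesis f_periodic : forall i c, f (i + Z.of_nat (S m))%Z c = f i c.
Hypothesis f_bound : forall i c, Rabs (f i c) <= Cf.
Hypothesis f_lip : forall i c, Rabs (f (i + 1)%Z c - f i c) <= Lf * h.
Hypothesis f_gravity : forall i, f i ax3 = G.
Let e : Z -> vec := fun i c => h * h * f i c.
Hypothesis q_loop : loop m q.
Hypothesis q_max :
  forall p, loop m p -> psum m (density e p) 0 <= psum m (density e q) 0.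

Definition vel (i : Z) : vec := fun c => (q (i + 1)%Z c - q i c) / h.
Definition speed2 (i : Z) : R := dot (vel i) (vel i).
(** The Lagrange multiplier of the sphere constraint, rescaled: the factor in the Euler-Lagrange
    equation is [2 + h * h * multiplier i]. The speeds of both adjacent edges enter through their
    mean. *)
Definition multiplier (i : Z) : R := dot (f i) (q i) - (speed2 i + speed2 (i - 1)) / 2.
(** The right-hand side of the limit equation at vertex [i]. It has the speed of one edge in place
    of the mean in [multiplier], which is an error of order [h]. *)
Definition acc (i : Z) : vec :=
  fun c => (dot (f i) (q i) - speed2 i) * q i c - f i c.

Let unit_q : forall i, dot (q i) (q i) = 1 := proj1 (proj2 q_loop).

Lemma speed2_dot (i : Z) : h * h * speed2 i = 2 - 2 * dot (q (i + 1)%Z) (q i).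
Proof.
  generalize (unit_q (i + 1)%Z), (unit_q i); unfold speed2, vel, dot; intros H1 H2.
  transitivity ((q (i + 1)%Z ax1 - q i ax1) ^ 2 + (q (i + 1)%Z ax2 - q i ax2) ^ 2
    + (q (i + 1)%Z ax3 - q i ax3) ^ 2); [field; lra|].
  lra.
Qed.

Lemma speed2_pos (i : Z) : 0 <= speed2 i.
Proof.
  unfold speed2, dot.
  generalize (Rle_0_sqr (vel i ax1)), (Rle_0_sqr (vel i ax2)), (Rle_0_sqr (vel i ax3)).
  unfold Rsqr; intros; lra.
Qed.

Lemma speed2_periodic (i : Z) : speed2 (i + Z.of_nat (S m)) = speed2 i.
Proof.
  pose proof q_loop as [Hp _]; unfold speed2, vel, dot.
  replace (i + Z.of_nat (S m) + 1)%Z with (i + 1 + Z.of_nat (S m))%Z by ring.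
  now rewrite !Hp.
Qed.

Lemma vel_step (i : Z) (c : axis) :
  vel i c - vel (i - 1)%Z c = h * (multiplier i * q i c - f i c).
Proof.
  destruct (maximal_loop_equation m e q m_pos) with (i := i) as [mu Hmu]; auto.
  - intros j c'; unfold e; now rewrite f_periodic.
  - intros j; unfold e; rewrite f_gravity; apply Rmult_lt_0_compat; nra.
  - assert (Hm : mu = 2 + h * h * multiplier i).
    { transitivity (mu * dot (q i) (q i)); [rewrite unit_q; ring|].
      transitivity (dot (q (i + 1)%Z) (q i) + dot (q i) (q (i - 1)%Z)
                    + h * h * dot (f i) (q i)).
      - generalize (Hmu ax1), (Hmu ax2), (Hmu ax3); unfold dot, e; intros H1 H2 H3.
        replace (mu * (q i ax1 * q i ax1 + q i ax2 * q i ax2 + q i ax3 * q i ax3))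
          with (mu * q i ax1 * q i ax1 + mu * q i ax2 * q i ax2
                + mu * q i ax3 * q i ax3) by ring.
        rewrite <- H1, <- H2, <- H3; ring.
      - generalize (speed2_dot i), (speed2_dot (i - 1)); unfold multiplier.
        replace (i - 1 + 1)%Z with i by ring; intros; lra. }
    specialize (Hmu c); unfold vel; replace (i - 1 + 1)%Z with i by ring.
    rewrite Hm in Hmu; unfold e in Hmu.
    transitivity ((q (i + 1)%Z c + q (i - 1)%Z c - 2 * q i c) / h); [field; lra|].
    replace (q (i + 1)%Z c + q (i - 1)%Z c - 2 * q i c)
      with (h * h * (multiplier i * q i c - f i c)) by lra.
    field; lra.
Qed.

Lemma q_coord (i : Z) (c : axis) : Rabs (q i c) <= 1.
Proof. apply unit_coord, unit_q. Qed.

Lemma forcing_dot_bound (i : Z) : Rabs (dot (f i) (q i)) <= 3 * Cf.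
Proof.
  replace (3 * Cf) with (3 * (Cf * 1)) by ring.
  apply dot_bound; [apply f_bound|apply q_coord].
Qed.

Lemma Cf_pos : 0 < Cf.
Proof.
  generalize (f_bound 0 ax3); rewrite f_gravity, Rabs_right; intros; lra.
Qed.

(** By [speed2_dot], [h * h / 2 * speed2 i + density e q i] equals [1 + h * h * dot (f i) (q i)],
    while the loop resting at the pole has density [1 + h * h * G]. Since [q] beats that loop, the
    kinetic sum is controlled by the force alone. *)
Lemma energy_bound (a : Z) : psum m speed2 a <= INR (S m) * (8 * Cf).
Proof.
  rewrite (psum_shift m speed2 a 0) by apply speed2_periodic.
  generalize (q_max _ (north_loop m)); intros H.
  assert (H1 : psum m (fun i => h * h / 2 * speed2 i + density e q i) 0
    <= psum m (fun i => h * h / 2 * (8 * Cf) + density e (fun _ => north) i) 0).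
  { apply psum_le; intros i.
    generalize (speed2_dot i); unfold density; intros Hs.
    assert (Hqf : dot (e i) (q i) <= h * h * (3 * Cf)).
    { replace (dot (e i) (q i)) with (h * h * dot (f i) (q i))
        by (unfold dot, e; ring).
      apply Rmult_le_compat_l; [nra|].
      apply Rle_trans with (1 := Rle_abs _), forcing_dot_bound. }
    assert (HN : dot north north + dot (e i) north = 1 + h * h * G).
    { unfold dot, e; simpl; rewrite f_gravity; ring. }
    rewrite HN; generalize Cf_pos; intros HC.
    assert (0 < h * h * Cf) by (apply Rmult_lt_0_compat; nra).
    assert (0 < h * h * G) by (apply Rmult_lt_0_compat; nra).
    lra. }
  rewrite !psum_plus, !psum_scal, psum_const in H1.
  apply Rmult_le_reg_l with (h * h / 2); [nra|lra].
Qed.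

(** The force contributes [4 * Cf * T] over a period. The two shifted energy sums contribute
    [4 * Cf * T] each. *)
Definition vel_cst : R := 12 * Cf * T.

(** By [vel_step] a velocity increment is at most [d i], which is linear in the speeds squared, so
    the total variation over one period is bounded by the energy. *)
Lemma vel_oscillation (a : Z) (c : axis) (k : nat) :
  (k <= m)%nat -> Rabs (vel (a + Z.of_nat k)%Z c - vel a c) <= vel_cst.
Proof.
  intros Hk.
  set (d := fun i => h * (4 * Cf) + (h / 2 * speed2 i + h / 2 * speed2 (i - 1))).
  assert (HC := Cf_pos).
  assert (Hd : forall i, 0 <= d i).
  { intros i; unfold d; generalize (speed2_pos i), (speed2_pos (i - 1)); intros.
    apply Rplus_le_le_0_compat; [apply Rmult_le_pos; lra|].
    apply Rplus_le_le_0_compat; apply Rmult_le_pos; lra. }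
  assert (Hstep : forall i, Rabs (vel i c - vel (i - 1)%Z c) <= d i).
  { intros i; rewrite vel_step, Rabs_mult, (Rabs_right h) by lra.
    unfold d; replace (h * (4 * Cf) + _)
      with (h * ((3 * Cf + (speed2 i + speed2 (i - 1)) / 2) * 1 + Cf)) by field.
    apply Rmult_le_compat_l; [lra|].
    apply Rabs_minus_le; [apply Rabs_mult_le; [|apply q_coord]|apply f_bound].
    apply Rabs_minus_le; [apply forcing_dot_bound|].
    generalize (speed2_pos i), (speed2_pos (i - 1)); intros.
    rewrite Rabs_right; lra. }
  apply Rle_trans with (psum k d a).
  - clear Hk; induction k as [|k IH].
    + rewrite Z.add_0_r, Rminus_diag, Rabs_R0.
      unfold psum; simpl; apply Hd.
    + unfold psum in *; rewrite tech5.
      specialize (Hstep (a + Z.of_nat (S k))%Z).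
      replace (a + Z.of_nat (S k) - 1)%Z with (a + Z.of_nat k)%Z in Hstep by lia.
      rewrite Rplus_comm.
      replace (_ - vel a c) with
        (vel (a + Z.of_nat (S k))%Z c - vel (a + Z.of_nat k)%Z c
         + (vel (a + Z.of_nat k)%Z c - vel a c)) by ring.
      now apply Rabs_plus_le.
  - apply Rle_trans with (psum m d a); [now apply psum_widen|].
    unfold d; rewrite !psum_plus, psum_const, !psum_scal.
    assert (Hsh : psum m (fun i => speed2 (i - 1)) a = psum m speed2 (a - 1)).
    { apply sum_eq; intros; f_equal; ring. }
    rewrite Hsh; unfold vel_cst; rewrite <- period.
    generalize (energy_bound a), (energy_bound (a - 1)); intros H1 H2.
    apply Rmult_le_compat_l with (r := h / 2) in H1; [|lra].
    apply Rmult_le_compat_l with (r := h / 2) in H2; [|lra].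
    lra.
Qed.

Lemma vel_mean_zero (a : Z) (c : axis) : psum m (fun i => vel i c) a = 0.
Proof.
  assert (H : forall k, psum k (fun i => vel i c) a
                        = (q (a + Z.of_nat (S k))%Z c - q a c) / h).
  { induction k as [|k IH].
    - unfold psum, vel; simpl; rewrite Z.add_0_r; reflexivity.
    - unfold psum in *; rewrite tech5, IH; unfold vel.
      replace (a + Z.of_nat (S (S k)))%Z with (a + Z.of_nat (S k) + 1)%Z by lia.
      field; lra. }
  rewrite H; pose proof q_loop as [Hp _]; rewrite Hp; field; lra.
Qed.

(** As the mean over a period vanishes, [- vel a c] is the average of the differences
    [vel i c - vel a c], each bounded by the oscillation. *)
Lemma vel_bound (a : Z) (c : axis) : Rabs (vel a c) <= vel_cst.
Proof.
  assert (HN : 0 < INR (S m)) by (apply lt_0_INR; lia).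
  apply Rmult_le_reg_r with (1 := HN).
  rewrite <- (Rabs_right (INR (S m))) at 1 by lra.
  rewrite <- Rabs_mult, <- Rabs_Ropp.
  replace (- (vel a c * INR (S m)))
    with (psum m (fun i => vel i c) a - sum_f_R0 (fun _ => vel a c) m)
    by (rewrite vel_mean_zero, sum_cte; ring).
  unfold psum; rewrite <- minus_sum, <- sum_cte.
  apply Rle_trans with (1 := Rsum_abs _ _), sum_Rle; intros k Hk.
  now apply vel_oscillation.
Qed.

Lemma vel_cst_pos : 0 <= vel_cst.
Proof. apply Rle_trans with (2 := vel_bound 0 ax1), Rabs_pos. Qed.

Definition vel_lip_cst : R := 4 * Cf + 3 * (vel_cst * vel_cst).

Lemma speed2_bound (i : Z) : Rabs (speed2 i) <= 3 * (vel_cst * vel_cst).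
Proof. apply dot_bound; apply vel_bound. Qed.

Lemma vel_lip_cst_pos : 0 <= vel_lip_cst.
Proof. unfold vel_lip_cst; generalize Cf_pos, vel_cst_pos; intros; nra. Qed.

Lemma q_lip (i : Z) (c : axis) : Rabs (q (i + 1)%Z c - q i c) <= vel_cst * h.
Proof.
  replace (q (i + 1)%Z c - q i c) with (vel i c * h) by (unfold vel; field; lra).
  apply Rabs_mult_le; [apply vel_bound|rewrite Rabs_right; lra].
Qed.

Lemma vel_lip (i : Z) (c : axis) : Rabs (vel (i + 1)%Z c - vel i c) <= vel_lip_cst * h.
Proof.
  generalize (vel_step (i + 1) c); replace (i + 1 - 1)%Z with i by ring.
  intros ->; rewrite Rmult_comm.
  apply Rabs_mult_le; [|rewrite Rabs_right; lra].
  replace vel_lip_cst with ((3 * Cf + 3 * (vel_cst * vel_cst)) * 1 + Cf) by (unfold vel_lip_cst; ring).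
  apply Rabs_minus_le; [apply Rabs_mult_le; [|apply q_coord]|apply f_bound].
  apply Rabs_minus_le; [apply forcing_dot_bound|].
  unfold Rdiv; replace (3 * (vel_cst * vel_cst)) with ((3 * (vel_cst * vel_cst) + 3 * (vel_cst * vel_cst)) * / 2) by field.
  apply Rabs_mult_le; [apply Rabs_plus_le; apply speed2_bound|].
  rewrite Rabs_right; lra.
Qed.

Lemma speed2_lip (i : Z) : Rabs (speed2 (i + 1) - speed2 i) <= 6 * vel_cst * vel_lip_cst * h.
Proof.
  replace (6 * vel_cst * vel_lip_cst * h) with (3 * (vel_lip_cst * h * vel_cst + vel_cst * (vel_lip_cst * h))) by ring.
  apply dot_minus_bound; auto using vel_bound, vel_lip.
Qed.

Definition acc_lip_cst : R :=
  (3 * Lf + 3 * Cf * vel_cst + 6 * vel_cst * vel_lip_cst) + (3 * Cf + 3 * (vel_cst * vel_cst)) * vel_cst + Lf.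

Lemma acc_lip (i : Z) (c : axis) : Rabs (acc (i + 1)%Z c - acc i c) <= acc_lip_cst * h.
Proof.
  unfold acc.
  replace (_ - _) with
    ((dot (f (i + 1)%Z) (q (i + 1)%Z) - speed2 (i + 1)) * q (i + 1)%Z c
     - (dot (f i) (q i) - speed2 i) * q i c - (f (i + 1)%Z c - f i c)) by ring.
  replace (acc_lip_cst * h) with
    ((3 * Lf + 3 * Cf * vel_cst + 6 * vel_cst * vel_lip_cst) * h * 1
     + (3 * Cf + 3 * (vel_cst * vel_cst)) * (vel_cst * h) + Lf * h) by (unfold acc_lip_cst; ring).
  apply Rabs_minus_le; [|apply f_lip].
  apply Rabs_mult_minus_le.
  - apply Rabs_minus_le; [apply forcing_dot_bound|apply speed2_bound].
  - apply q_coord.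
  - replace (_ - _) with
      (dot (f (i + 1)%Z) (q (i + 1)%Z) - dot (f i) (q i)
       - (speed2 (i + 1) - speed2 i)) by ring.
    replace ((3 * Lf + 3 * Cf * vel_cst + 6 * vel_cst * vel_lip_cst) * h)
      with (3 * (Lf * h * 1 + Cf * (vel_cst * h)) + 6 * vel_cst * vel_lip_cst * h) by ring.
    apply Rabs_minus_le; [|apply speed2_lip].
    apply dot_minus_bound; auto using q_coord, q_lip.
  - apply q_lip.
Qed.

Lemma acc_lip_cst_pos : 0 <= acc_lip_cst.
Proof.
  apply Rmult_le_reg_r with (1 := h_pos); rewrite Rmult_0_l.
  apply Rle_trans with (2 := acc_lip 0 ax1), Rabs_pos.
Qed.

(** The velocity increment is [h] times the acceleration at [i + 1] computed with the mean speed.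
    Passing to [acc i] costs half an increment of [speed2] and one increment of [acc], both of order
    [h]. *)
Lemma vel_acc (i : Z) (c : axis) :
  Rabs (vel (i + 1)%Z c - vel i c - h * acc i c) <= (3 * vel_cst * vel_lip_cst + acc_lip_cst) * h ^ 2.
Proof.
  generalize (vel_step (i + 1) c); replace (i + 1 - 1)%Z with i by ring.
  intros ->.
  replace (_ - _) with
    (h * ((speed2 (i + 1) - speed2 i) * / 2 * q (i + 1)%Z c + (acc (i + 1)%Z c - acc i c))).
  - replace ((3 * vel_cst * vel_lip_cst + acc_lip_cst) * h ^ 2) with (h * (6 * vel_cst * vel_lip_cst * h * / 2 * 1 + acc_lip_cst * h)) by field.
    apply Rabs_mult_le; [rewrite Rabs_right; lra|].
    apply Rabs_plus_le; [|apply acc_lip].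
    apply Rabs_mult_le; [|apply q_coord].
    apply Rabs_mult_le; [apply speed2_lip|rewrite Rabs_right; lra].
  - unfold acc, multiplier; replace (i + 1 - 1)%Z with i by ring; field.
Qed.

Lemma q_taylor (i j : Z) (c : axis) :
  Rabs (q j c - q i c - (h * IZR j - h * IZR i) * vel i c)
  <= Rabs (h * IZR j - h * IZR i) * (0 * h + 2 * vel_lip_cst * Rabs (h * IZR j - h * IZR i)).
Proof.
  apply (discrete_taylor h 0 vel_lip_cst (fun k => q k c) (fun k => vel k c));
    auto using vel_lip_cst_pos, vel_lip.
  (* The velocity is the exact difference quotient, so the one-step error is zero. *)
  intros k; unfold vel; replace (_ - _) with 0 by (field; lra).
  rewrite Rabs_R0; lra.
Qed.

Lemma vel_taylor (i j : Z) (c : axis) :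
  Rabs (vel j c - vel i c - (h * IZR j - h * IZR i) * acc i c)
  <= Rabs (h * IZR j - h * IZR i)
     * ((3 * vel_cst * vel_lip_cst + acc_lip_cst) * h + 2 * acc_lip_cst * Rabs (h * IZR j - h * IZR i)).
Proof.
  apply (discrete_taylor h _ acc_lip_cst (fun k => vel k c) (fun k => acc k c));
    auto using acc_lip_cst_pos, vel_acc, acc_lip.
Qed.

(* At the lowest vertex the second difference of the height is nonnegative, so
   the multiplier times the height is at least [G]. *)
Lemma height_bound (i : Z) : G / (3 * Cf) <= q i ax3.
Proof.
  pose proof q_loop as [Hp [_ Hz]].
  assert (HC := Cf_pos).
  destruct (argmin (fun k => q (Z.of_nat k) ax3) m) as [j [Hj Hmin]].
  assert (Hper : forall (k : nat) i, q (i + Z.of_nat k * Z.of_nat (S m))%Z ax3 = q i ax3).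
  { induction k as [|k IH]; intros l; [now rewrite Z.add_0_r|].
    rewrite (Nat2Z.inj_succ k), Z.mul_succ_l, Z.add_assoc, Hp; apply IH. }
  assert (Hper' : forall k i, q (i + k * Z.of_nat (S m))%Z ax3 = q i ax3).
  { intros k l; destruct (Z_le_gt_dec 0 k).
    - rewrite <- (Z2Nat.id k) by lia; apply Hper.
    - rewrite <- (Hper (Z.to_nat (- k)) (l + _)%Z), Z2Nat.id by lia.
      f_equal; ring. }
  (* The minimum over one period is global, by reduction modulo [S m]. *)
  assert (Hglob : forall l, q (Z.of_nat j) ax3 <= q l ax3).
  { intros l; assert (HP : (0 < Z.of_nat (S m))%Z) by lia.
    generalize (Z.mod_pos_bound l _ HP), (Z_div_mod_eq_full l (Z.of_nat (S m))).
    intros Hb Heq; rewrite Heq, Z.add_comm, Z.mul_comm, Hper'.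
    rewrite <- (Z2Nat.id (l mod Z.of_nat (S m))) by lia; apply Hmin; lia. }
  apply Rle_trans with (2 := Hglob i).
  set (k := Z.of_nat j) in *.
  assert (Hs : 0 <= vel k ax3 - vel (k - 1)%Z ax3).
  { unfold vel; replace (k - 1 + 1)%Z with k by ring.
    generalize (Hglob (k + 1)%Z), (Hglob (k - 1)%Z); intros H1 H2.
    replace (_ - _) with
      ((q (k + 1)%Z ax3 - q k ax3 + (q (k - 1)%Z ax3 - q k ax3)) / h) by (field; lra).
    apply Rdiv_le_0_compat; lra. }
  rewrite vel_step, f_gravity in Hs.
  (* The speeds enter with a negative sign, so the force alone bounds the multiplier from above. *)
  assert (Hm : multiplier k <= 3 * Cf).
  { unfold multiplier; generalize (forcing_dot_bound k), (Rle_abs (dot (f k) (q k))),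
      (speed2_pos k), (speed2_pos (k - 1)); intros; lra. }
  assert (HG : 0 <= multiplier k * q k ax3 - G).
  { apply Rmult_le_reg_l with (1 := h_pos); lra. }
  apply Rmult_le_reg_l with (3 * Cf); [lra|].
  replace (3 * Cf * (G / (3 * Cf))) with G by (field; lra).
  generalize (Rmult_le_compat_r _ _ _ (Hz k) Hm); intros; lra.
Qed.

End Estimates.

(** * The continuum limit *)

(** Collects the estimates with constants chosen before [m], which is what lets them survive
    refinement of the mesh. *)
Lemma discrete_solutions (T G Cf Lf : R) (F : R -> vec) :
  0 < T -> 0 < G ->
  (forall t c, F (t + T) c = F t c) ->
  (forall t c, Rabs (F t c) <= Cf) ->
  (forall t s c, Rabs (F t c - F s c) <= Lf * Rabs (t - s)) ->
  (forall t, F t ax3 = G) ->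
  exists z0 B E M, 0 < z0 /\
    forall m, (1 <= m)%nat -> let h := T / INR (S m) in
    exists q v : Z -> vec,
      (forall i c, q (i + Z.of_nat (S m))%Z c = q i c) /\
      (forall i, dot (q i) (q i) = 1) /\
      (forall i, z0 <= q i ax3) /\
      (forall i c, Rabs (v i c) <= B) /\
      (forall i j c, let d := h * IZR j - h * IZR i in
        Rabs (q j c - q i c - d * v i c) <= Rabs d * (E * h + M * Rabs d)) /\
      (forall i j c, let d := h * IZR j - h * IZR i in
        Rabs (v j c - v i c
          - d * ((dot (F (h * IZR i)) (q i) - dot (v i) (v i)) * q i c
                 - F (h * IZR i) c))
          <= Rabs d * (E * h + M * Rabs d)).
Proof.
  intros HT HG HF HC HL H3.
  set (k := vel_cst T Cf); set (mm := vel_lip_cst T Cf); set (a := acc_lip_cst T Cf Lf).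
  (* Common constants give the Taylor estimates of [q] and of [v] the same shape; the absolute value
     also dominates the error 0 of [q]. *)
  set (E := Rabs (3 * k * mm + a)); set (N := Rmax (2 * mm) (2 * a)).
  exists (G / (3 * Cf)), k, E, N; split.
  - apply Rdiv_lt_0_compat; [exact HG|].
    generalize (HC 0 ax3); rewrite H3, Rabs_right; intros; lra.
  - intros m Hm h.
    assert (HN : 0 < INR (S m)) by (apply lt_0_INR; lia).
    assert (Hh : 0 < h) by now apply Rdiv_lt_0_compat.
    assert (Hper : h * INR (S m) = T) by (unfold h; field; lra).
    set (f := fun i => F (h * IZR i)).
    assert (Hf : forall i c, f (i + Z.of_nat (S m))%Z c = f i c).
    { intros i c; unfold f; rewrite plus_IZR, <- INR_IZR_INZ, Rmult_plus_distr_l, Hper.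
      apply HF. }
    assert (HfC : forall i c, Rabs (f i c) <= Cf) by (intros; apply HC).
    assert (HfL : forall i c, Rabs (f (i + 1)%Z c - f i c) <= Lf * h).
    { intros i c; apply Rle_trans with (1 := HL _ _ c); right; f_equal.
      rewrite plus_IZR, Rabs_right; ring_simplify; lra. }
    assert (Hf3 : forall i, f i ax3 = G) by (intros; apply H3).
    destruct (exists_maximal_loop m (fun i c => h * h * f i c)) as [q [Hq Hmax]].
    assert (Hd : forall d E', E' <= E -> forall M', M' <= N ->
      Rabs d * (E' * h + M' * Rabs d) <= Rabs d * (E * h + N * Rabs d)).
    { intros d E' HE M' HM; apply Rmult_le_compat_l; [apply Rabs_pos|].
      apply Rplus_le_compat; apply Rmult_le_compat_r; try lra; apply Rabs_pos. }
    exists q, (vel h q); refine (conj _ (conj _ (conj _ (conj _ (conj _ _))))).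
    + apply Hq.
    + apply Hq.
    + intros i; now apply height_bound with (m := m) (h := h) (f := f).
    + intros i c; now apply vel_bound with (m := m) (G := G) (f := f).
    + intros i j c d; eapply Rle_trans;
        [now apply q_taylor with (m := m) (T := T) (G := G) (Cf := Cf) (f := f)|].
      apply Hd; [apply Rabs_pos|apply Rmax_l].
    + intros i j c d; eapply Rle_trans;
        [now apply vel_taylor with (m := m) (T := T) (G := G) (Cf := Cf) (Lf := Lf) (f := f)|].
      apply Hd; [apply Rle_abs|apply Rmax_r].
Qed.

Lemma is_derive_of_quadratic_remainder (a b : R -> R) (C s : R) :
  (forall t, Rabs (a t - a s - (t - s) * b s) <= Rabs (t - s) * (C * Rabs (t - s))) ->
  is_derive a s (b s).
Proof.
  intros H; apply is_derive_Reals; intros eps Heps.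
  assert (HC : 0 < Rabs C + 1) by (generalize (Rabs_pos C); intros; lra).
  exists (mkposreal _ (Rdiv_lt_0_compat _ _ Heps HC)); simpl; intros h Hh Hd.
  specialize (H (s + h)); replace (s + h - s) with h in H by ring.
  assert (Hp : 0 < Rabs h) by now apply Rabs_pos_lt.
  replace ((a (s + h) - a s) / h - b s) with ((a (s + h) - a s - h * b s) / h)
    by (field; exact Hh).
  unfold Rdiv; rewrite Rabs_mult, Rabs_inv.
  apply Rle_lt_trans with (C * Rabs h).
  - apply Rmult_le_reg_r with (1 := Hp).
    rewrite Rmult_assoc, Rinv_l by lra; lra.
  - apply Rle_lt_trans with ((Rabs C + 1) * Rabs h).
    + apply Rmult_le_compat_r; [lra|generalize (Rle_abs C); intros; lra].
    + rewrite Rmult_comm; apply Rlt_div_r in Hd; lra.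
Qed.

(** Loops are extended to real times as step functions. Taking the floor makes a shift of time by a
    multiple of [h] an exact shift of the index. *)
Definition node (h t : R) : Z := Int_part (t / h).

Lemma node_close (h t : R) : 0 < h -> Rabs (h * IZR (node h t) - t) <= h.
Proof.
  intros Hh; unfold node; destruct (base_Int_part (t / h)) as [H1 H2].
  set (k := IZR (Int_part (t / h))) in *.
  assert (Ht : t = h * (t / h)) by (field; lra).
  rewrite Ht, <- Rmult_minus_distr_l.
  rewrite Rabs_mult, (Rabs_right h) by lra.
  apply Rle_trans with (h * 1); [|lra].
  apply Rmult_le_compat_l; [lra|apply Rabs_le; lra].
Qed.

Lemma node_shift (h t : R) (k : Z) :
  0 < h -> node h (t + h * IZR k) = (node h t + k)%Z.
Proof.
  intros Hh; unfold node; symmetry; apply Int_part_spec.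
  destruct (base_Int_part (t / h)) as [H1 H2].
  replace ((t + h * IZR k) / h) with (t / h + IZR k) by (field; lra).
  rewrite plus_IZR; lra.
Qed.

Lemma mesh_lim (T : R) : is_lim_seq (fun n => T / INR (n + 2)) 0.
Proof.
  replace (Finite 0) with (Rbar_mult T (Rbar_inv p_infty))
    by (simpl; f_equal; ring).
  apply is_lim_seq_scal_l, is_lim_seq_inv; [|discriminate].
  apply (is_lim_seq_incr_n INR 2), is_lim_seq_INR.
Qed.

(** Only pointwise limits of step functions are taken. Regularity comes from the Taylor
    inequalities: they hold in the limit with a purely quadratic remainder, and this is already
    differentiability with the prescribed derivative. *)
Lemma periodic_solution_on_sphere (T G Cf Lf : R) (F : R -> vec) :
  0 < T -> 0 < G ->
  (forall t c, F (t + T) c = F t c) ->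
  (forall t c, Rabs (F t c) <= Cf) ->
  (forall t s c, Rabs (F t c - F s c) <= Lf * Rabs (t - s)) ->
  (forall t, F t ax3 = G) ->
  exists Q V : R -> vec,
    (forall t c, Q (t + T) c = Q t c) /\
    (forall t, dot (Q t) (Q t) = 1) /\
    (forall t, 0 < Q t ax3) /\
    (forall t c, is_derive (fun s => Q s c) t (V t c)) /\
    (forall t c, is_derive (fun s => V s c) t
       ((dot (F t) (Q t) - dot (V t) (V t)) * Q t c - F t c)).
Proof.
  intros HT HG HF HC HL H3.
  destruct (discrete_solutions T G Cf Lf F HT HG HF HC HL H3)
    as [z0 [B [E [N [Hz0 Hm]]]]].
  (* The [n]-th loop has [n + 2] vertices, so that there are always at least two. *)
  set (h := fun n => T / INR (n + 2)).
  assert (Hn : forall n, exists qv : (Z -> vec) * (Z -> vec),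
    let q := fst qv in let v := snd qv in
      (forall i c, q (i + Z.of_nat (n + 2))%Z c = q i c) /\
      (forall i, dot (q i) (q i) = 1) /\
      (forall i, z0 <= q i ax3) /\
      (forall i c, Rabs (v i c) <= B) /\
      (forall i j c, let d := h n * IZR j - h n * IZR i in
        Rabs (q j c - q i c - d * v i c) <= Rabs d * (E * h n + N * Rabs d)) /\
      (forall i j c, let d := h n * IZR j - h n * IZR i in
        Rabs (v j c - v i c
          - d * ((dot (F (h n * IZR i)) (q i) - dot (v i) (v i)) * q i c
                 - F (h n * IZR i) c))
          <= Rabs d * (E * h n + N * Rabs d))).
  { intros n; destruct (Hm (n + 1)%nat) as [q [v H]]; [lia|].
    exists (q, v); unfold h; replace (n + 2)%nat with (S (n + 1)) by lia.
    exact H. }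
  destruct (boolp.choice Hn) as [qv Hqv]; clear Hm Hn; cbv zeta in Hqv.
  assert (Hh : forall n, 0 < h n).
  { intros n; apply Rdiv_lt_0_compat; [exact HT|apply lt_0_INR; lia]. }
  set (q := fun n t => fst (qv n) (node (h n) t)).
  set (v := fun n t => snd (qv n) (node (h n) t)).
  set (tau := fun n t => h n * IZR (node (h n) t)).
  destruct nonprincipal_ultrafilter as [U [UU [ultra Ule]]].
  assert (Hh0 : filterlim h U (locally 0)).
  { apply (filterlim_filter_le_1 _ Ule), mesh_lim. }
  assert (Htau : forall t, filterlim (fun n => tau n t) U (locally t)).
  { intros t; apply (filterlim_filter_le_1 _ Ule).
    change (is_lim_seq (fun n => tau n t) t).
    apply (is_lim_seq_le_le (fun n => t - h n) _ (fun n => t + h n)).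
    - intros n; generalize (node_close (h n) t (Hh n)); fold (tau n t).
      intros HR; apply Rabs_le_between in HR; lra.
    - rewrite <- (Rminus_0_r t) at 1.
      apply is_lim_seq_minus'; [apply is_lim_seq_const|apply mesh_lim].
    - rewrite <- (Rplus_0_r t) at 1.
      apply is_lim_seq_plus'; [apply is_lim_seq_const|apply mesh_lim]. }
  assert (HQ : forall tc : R * axis, exists l,
    filterlim (fun n => q n (fst tc) (snd tc)) U (locally l)).
  { intros [t c]; apply (ultrafilter_limit U ultra _ 1); intros n.
    apply unit_coord, (Hqv n). }
  assert (HV : forall tc : R * axis, exists l,
    filterlim (fun n => v n (fst tc) (snd tc)) U (locally l)).
  { intros [t c]; apply (ultrafilter_limit U ultra _ B); intros n.
    apply (Hqv n). }
  destruct (boolp.choice HQ) as [Q' HQ']; destruct (boolp.choice HV) as [V' HV'].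
  set (Q := fun t c => Q' (t, c)); set (V := fun t c => V' (t, c)).
  assert (limQ : forall t c, filterlim (fun n => q n t c) U (locally (Q t c)))
    by (intros t c; exact (HQ' (t, c))).
  assert (limV : forall t c, filterlim (fun n => v n t c) U (locally (V t c)))
    by (intros t c; exact (HV' (t, c))).
  assert (limF : forall t c, filterlim (fun n => F (tau n t) c) U (locally (F t c))).
  { intros t c; apply (flim_continuous (fun s => F s c)); [|apply Htau].
    apply filterlim_locally; intros eps.
    assert (HLp : 0 < Rabs Lf + 1) by (generalize (Rabs_pos Lf); intros; lra).
    exists (mkposreal _ (Rdiv_lt_0_compat _ _ (cond_pos eps) HLp)); intros s Hs.
    apply Rle_lt_trans with (1 := HL s t c).
    apply Rle_lt_trans with ((Rabs Lf + 1) * Rabs (s - t)).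
    - apply Rmult_le_compat_r; [apply Rabs_pos|].
      generalize (Rle_abs Lf); intros; lra.
    - change (Rabs (s - t) < eps / (Rabs Lf + 1)) in Hs.
      rewrite Rmult_comm; apply Rlt_div_r in Hs; lra. }
  assert (limdot : forall (a b : nat -> vec) (x y : vec),
    (forall c, filterlim (fun n => a n c) U (locally (x c))) ->
    (forall c, filterlim (fun n => b n c) U (locally (y c))) ->
    filterlim (fun n => dot (a n) (b n)) U (locally (dot x y))).
  { intros a b x y Ha Hb; unfold dot.
    repeat apply flim_plus; apply flim_mult; auto. }
  (* In the limit [tau n t] becomes [t] and the term [E * h n] disappears. The lemma is used once
     for the position and once for the velocity. *)
  assert (Hderiv : forall (a b : nat -> R -> R) (a' b' : R -> R),
    (forall n s t, Rabs (a n t - a n s - (tau n t - tau n s) * b n s)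
       <= Rabs (tau n t - tau n s) * (E * h n + N * Rabs (tau n t - tau n s))) ->
    (forall t, filterlim (fun n => a n t) U (locally (a' t))) ->
    (forall t, filterlim (fun n => b n t) U (locally (b' t))) ->
    forall s, is_derive a' s (b' s)).
  { intros a b a' b' Hab Ha Hb s.
    apply (is_derive_of_quadratic_remainder a' b' N); intros t.
    apply (flim_le (U := U) _ _ _ _ (fun n => Hab n s t)).
    - apply flim_abs, flim_minus; [now apply flim_minus|].
      apply flim_mult; [now apply flim_minus|apply Hb].
    - assert (Hd : filterlim (fun n => Rabs (tau n t - tau n s)) U
                     (locally (Rabs (t - s)))) by now apply flim_abs, flim_minus.
      apply flim_mult; [exact Hd|].
      replace (N * Rabs (t - s)) with (E * 0 + N * Rabs (t - s)) by ring.
      apply flim_plus; apply flim_mult; auto using flim_const. }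
  exists Q, V; refine (conj _ (conj _ (conj _ (conj _ _)))).
  - intros t c; apply (flim_unique (U := U) (fun n => q n t c)); [|apply limQ].
    apply filterlim_ext with (2 := limQ (t + T) c); intros n; unfold q.
    (* [T] is exactly [n + 2] mesh steps, so the limit inherits the period of the loops. *)
    replace T with (h n * IZR (Z.of_nat (n + 2))).
    + rewrite node_shift by apply Hh; apply (Hqv n).
    + rewrite <- INR_IZR_INZ; unfold h; field; apply not_0_INR; lia.
  - intros t; apply (flim_unique (U := U) (fun _ => 1)); [|apply flim_const].
    apply filterlim_ext with (2 := limdot _ _ _ _ (limQ t) (limQ t)); intros n.
    apply (Hqv n).
  - intros t; apply Rlt_le_trans with (1 := Hz0).
    apply (flim_le (U := U) (fun _ => z0) (fun n => q n t ax3));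
      [intros n; apply (Hqv n)|apply flim_const|apply limQ].
  - intros t c.
    apply (Hderiv (fun n t => q n t c) (fun n t => v n t c)
             (fun s => Q s c) (fun s => V s c)); auto.
    intros n s s'; apply (Hqv n).
  - intros t c.
    apply (Hderiv (fun n t => v n t c)
      (fun n t => (dot (F (tau n t)) (q n t) - dot (v n t) (v n t)) * q n t c
                  - F (tau n t) c)
      (fun s => V s c)
      (fun t => (dot (F t) (Q t) - dot (V t) (V t)) * Q t c - F t c)); auto.
    + intros n s s'; apply (Hqv n).
    + intros s; apply flim_minus; [|apply limF].
      apply flim_mult; [apply flim_minus; apply limdot|]; auto.
Qed.

(** * Periodic functions, and the return from the sphere to the disc *)

Lemma periodic_IZR (g : R -> R) (T : R) :
  (forall t, g (t + T) = g t) -> forall (k : Z) t, g (t + IZR k * T) = g t.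
Proof.
  intros Hg.
  assert (Hn : forall (n : nat) t, g (t + INR n * T) = g t).
  { induction n as [|n IH]; intros t.
    - f_equal; simpl; ring.
    - rewrite S_INR, <- (IH t), <- (Hg (t + INR n * T)); f_equal; ring. }
  intros k t; destruct (Z_le_gt_dec 0 k).
  - rewrite <- (Z2Nat.id k), <- INR_IZR_INZ by lia; apply Hn.
  - rewrite <- (Hn (Z.to_nat (- k)) (t + _)), (INR_IZR_INZ (Z.to_nat _)).
    rewrite Z2Nat.id, opp_IZR by lia; f_equal; ring.
Qed.

Lemma continuous_periodic_bounded (g : R -> R) (T : R) :
  0 < T -> (forall t, continuous g t) -> (forall t, g (t + T) = g t) ->
  exists C, forall t, Rabs (g t) <= C.
Proof.
  intros HT Hc Hg.
  destruct (continuity_ab_maj (fun t => Rabs (g t)) 0 T) as [t0 [Ht0 _]].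
  - lra.
  - intros c _; apply continuity_pt_filterlim.
    exact (continuous_comp g Rabs c (Hc c) (continuous_Rabs (g c))).
  - exists (Rabs (g t0)); intros t.
    rewrite <- (periodic_IZR g T Hg (- Int_part (t / T)) t); apply Ht0.
    destruct (base_Int_part (t / T)) as [H1 H2].
    rewrite opp_IZR.
    replace (t + - IZR (Int_part (t / T)) * T)
      with ((t / T - IZR (Int_part (t / T))) * T) by (field; lra).
    split; [apply Rmult_le_pos; lra|].
    apply Rle_trans with (1 * T); [apply Rmult_le_compat_r|]; lra.
Qed.

Lemma C1_periodic_bounds (g : R -> R) (T : R) :
  0 < T -> is_C1 g -> (forall t, g (t + T) = g t) ->
  exists C L, (forall t, Rabs (g t) <= C) /\
    (forall t s, Rabs (g t - g s) <= L * Rabs (t - s)).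
Proof.
  intros HT [Hex Hcd] Hg.
  assert (Hc : forall t, continuous g t)
    by (intros t; exact (ex_derive_continuous g t (Hex t))).
  destruct (continuous_periodic_bounded g T HT Hc Hg) as [C HC].
  destruct (continuous_periodic_bounded (Derive g) T HT Hcd) as [L HL].
  (* Differentiating [g (s + T) = g s] shows that the derivative is periodic too, hence bounded; the
     mean value theorem makes this bound a Lipschitz constant. *)
  { intros t; symmetry; apply is_derive_unique.
    apply is_derive_ext with (f := fun s => g (s + T)); [exact Hg|].
    auto_derive; [apply Hex|apply Rmult_1_l]. }
  exists C, L; split; [exact HC|].
  intros t s; destruct (MVT_gen g s t (Derive g)) as [c [_ Hceq]].
  - intros x _; apply Derive_correct, Hex.
  - intros x _; apply continuity_pt_filterlim, Hc.
  - rewrite Hceq, Rabs_mult; apply Rmult_le_compat_r; [apply Rabs_pos|apply HL].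
Qed.

Lemma is_derive_square (g : R -> R) (t l : R) :
  is_derive g t l -> is_derive (fun s => g s * g s) t (2 * (g t * l)).
Proof.
  intros H; replace (2 * (g t * l)) with (l * g t + g t * l) by ring.
  exact (is_derive_mult g g t l l H H Rmult_comm).
Qed.

(** Differentiate the constant function [dot (Q s) (Q s)]. *)
Lemma unit_tangent (Q : R -> vec) (t : R) (w : vec) :
  (forall s, dot (Q s) (Q s) = 1) ->
  (forall c, is_derive (fun s => Q s c) t (w c)) -> dot (Q t) w = 0.
Proof.
  intros HQ Hw.
  generalize (is_derive_plus _ _ _ _ _
    (is_derive_plus _ _ _ _ _ (is_derive_square _ _ _ (Hw ax1))
                              (is_derive_square _ _ _ (Hw ax2)))
    (is_derive_square _ _ _ (Hw ax3))); intros Hd.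
  apply is_derive_unique in Hd.
  rewrite (Derive_ext _ (fun _ => 1)), Derive_const in Hd by exact HQ.
  unfold dot; unfold plus in Hd; simpl in Hd; lra.
Qed.

(* F = (F1, F2), x = (x1, x2), xdot = (v1, v2); x is twice differentiable with
   x' = v and v' = right-hand side of the equation. *)
Theorem theorem4p3 (G T : R) (F1 F2 : R -> R) :
  0 < G -> 0 < T ->
  is_C1 F1 -> is_C1 F2 ->
  (forall t, F1 (t + T) = F1 t /\ F2 (t + T) = F2 t) ->
  exists x1 x2 v1 v2 : R -> R,
    (forall t, nrm2 (x1 t) (x2 t) < 1) /\
    (forall t, x1 (t + T) = x1 t /\ x2 (t + T) = x2 t) /\
    (forall t, is_derive x1 t (v1 t) /\ is_derive x2 t (v2 t)) /\
    (forall t,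
       let c := coef G (x1 t) (x2 t) (v1 t) (v2 t) in
       let p := dot2 (x1 t) (x2 t) (F1 t) (F2 t) in
       is_derive v1 t (c * x1 t + p * x1 t - F1 t) /\
       is_derive v2 t (c * x2 t + p * x2 t - F2 t)).
Proof.
  intros HG HT HF1 HF2 Hper.
  destruct (C1_periodic_bounds F1 T HT HF1) as [C1 [L1 [HC1 HL1]]]; [apply Hper|].
  destruct (C1_periodic_bounds F2 T HT HF2) as [C2 [L2 [HC2 HL2]]]; [apply Hper|].
  (* The constant third component is gravity; it enters the equation with a minus sign. *)
  set (F := fun t c => match c with ax1 => F1 t | ax2 => F2 t | ax3 => G end).
  destruct (periodic_solution_on_sphere T G (Rabs C1 + Rabs C2 + G) (Rabs L1 + Rabs L2) F)
    as [Q [V [HQper [HQ [Hz [HdQ HdV]]]]]]; auto.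
  - intros t []; simpl; auto; apply Hper.
  - intros t c; generalize (Rle_abs C1), (Rle_abs C2), (Rabs_pos C1), (Rabs_pos C2),
      (HC1 t), (HC2 t); intros; destruct c; simpl; try rewrite (Rabs_right G); lra.
  - intros t s c.
    apply Rle_trans with (Rabs L1 * Rabs (t - s) + Rabs L2 * Rabs (t - s)); [|lra].
    generalize (Rabs_pos (t - s)), (HL1 t s), (HL2 t s); intros Hp H1 H2.
    generalize (Rmult_le_compat_r _ _ _ Hp (Rle_abs L1)),
      (Rmult_le_compat_r _ _ _ Hp (Rle_abs L2)),
      (Rmult_le_pos _ _ (Rabs_pos L1) Hp), (Rmult_le_pos _ _ (Rabs_pos L2) Hp); intros.
    destruct c; simpl; rewrite ?Rminus_diag, ?Rabs_R0; lra.
  - assert (Htan : forall t, dot (Q t) (V t) = 0).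
    { intros t; apply unit_tangent; auto. }
    assert (Hz2 : forall t, 1 - nrm2 (Q t ax1) (Q t ax2) = Q t ax3 * Q t ax3).
    { intros t; generalize (HQ t); unfold dot, nrm2; intros; lra. }
    (* The positive height [Q t ax3] is the square root in [coef], so the third term of the force
       product is [G * sqrt (1 - |x|^2)]. Tangency expresses the vertical velocity as minus the
       product [x.v] divided by the height, and its square is the fraction in [coef]. *)
    assert (Hcoef : forall t,
      dot (F t) (Q t) - dot (V t) (V t)
      = coef G (Q t ax1) (Q t ax2) (V t ax1) (V t ax2)
        + dot2 (Q t ax1) (Q t ax2) (F1 t) (F2 t)).
    { intros t; unfold coef; rewrite Hz2, sqrt_square by apply Rlt_le, Hz.
      assert (Hxv : dot2 (Q t ax1) (Q t ax2) (V t ax1) (V t ax2)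
                    = - (Q t ax3 * V t ax3)).
      { generalize (Htan t); unfold dot, dot2; intros; lra. }
      rewrite Hxv; unfold dot, dot2, nrm2, F.
      field; apply Rgt_not_eq, Hz. }
    exists (fun t => Q t ax1), (fun t => Q t ax2), (fun t => V t ax1), (fun t => V t ax2).
    refine (conj _ (conj _ (conj _ _))); intros t.
    + generalize (Hz2 t), (Rmult_lt_0_compat _ _ (Hz t) (Hz t)); intros; lra.
    + split; apply HQper.
    + exact (conj (HdQ t ax1) (HdQ t ax2)).
    + generalize (HdV t ax1), (HdV t ax2); simpl.
      rewrite Hcoef, !Rmult_plus_distr_r; intros Hd1 Hd2; exact (conj Hd1 Hd2).
Qed.
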